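(* Let $\beta>0$, let $(\phi_t,\psi_t)$, $t=0,\dots,T$, be the iterates of the OT dual ascent algorithm (defined in the context) with step size $0<\eta\le1/\beta$, and write $\boldsymbol\lambda_t=(\phi_t,\psi_t)$. Let $M,s>0$ be such that $\min_{i\in[m]}\mu_i\ge s$, $\min_{j\in[n]}\nu_j\ge s$ and $\max_{i,j}|c_{ij}|\le M$. Let $\boldsymbol\lambda_\star=(\phi_\star,\psi_\star)$ be a minimizer of $f_\beta$. Then for all $t=1,\dots,T$, $$f_\beta(\boldsymbol\lambda_t)-f_\beta(\boldsymbol\lambda_\star)\le\frac{32\left[2M+\frac{\log(1/s)+1}{\beta}\right]^2}{t\,\eta}.$$
   Context: Let $\mu\in\Delta_m$, $\nu\in\Delta_n$ be probability vectors and $c\in\mathbb{R}^{m\times n}$ a cost matrix. $[n]=\{1,\dots,n\}$; $\mathbf{1}_n$ is the all-ones vector in $\mathbb{R}^n$. For $\beta>0$ define on $\mathbb{R}^m\times\mathbb{R}^n$ the (negated) dual objective of entropically regularized optimal transport $$f_\beta(\phi,\psi)=-\mu^\top\phi-\nu^\top\psi+\beta^{-1}\log\sum_{i,j}e^{-\beta(c_{ij}-\phi_i-\psi_j)},$$ and let $\pi_{\beta,(\phi,\psi)}\in\mathbb{R}^{m\times n}$ be the matrix with entries proportional to $e^{-\beta(c_{ij}-\phi_i-\psi_j)}$, normalized so that the entries sum to $1$. OT dual ascent algorithm with step size $\eta$: start with $\phi_0=0$, $\psi_0=0$. For $t=0,1,2,\dots$ set $\pi_t=\pi_{\beta,(\phi_t,\psi_t)}$,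 $\mu_t=\pi_t\mathbf{1}_n$, $\nu_t=\pi_t^\top\mathbf{1}_m$, and $$\tilde\phi_t=\phi_t-\tfrac{\eta}{2}\|\mu_t-\mu\|_1\,\mathrm{sign}(\mu_t-\mu),\qquad \tilde\psi_t=\psi_t-\tfrac{\eta}{2}\|\nu_t-\nu\|_1\,\mathrm{sign}(\nu_t-\nu),$$ $$\phi_{t+1}=\tilde\phi_t-\big(\tfrac1m\mathbf{1}_m^\top\tilde\phi_t\big)\mathbf{1}_m,\qquad \psi_{t+1}=\tilde\psi_t-\big(\tfrac1n\mathbf{1}_n^\top\tilde\psi_t\big)\mathbf{1}_n,$$ where $\mathrm{sign}$ acts entrywise (with $\mathrm{sign}(0)=0$). *)

(* Defs.v *)
From HB Require Import structures.
From mathcomp Require Import all_boot all_order all_algebra.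
From mathcomp Require Import reals sequences exp.

Set Implicit Arguments.
Unset Strict Implicit.
Unset Printing Implicit Defensive.

Import Order.TTheory GRing.Theory Num.Theory.
Local Open Scope ring_scope.

Definition prob_vec (R : realType) (n : nat) (p : 'cV[R]_n) : Prop :=
  (forall i, 0 <= p i 0) /\ \sum_i p i 0 = 1.

Definition dotv (R : realType) (n : nat) (u v : 'cV[R]_n) : R :=
  (u^T *m v) 0 0.

(* The library norm on matrices is the sup norm, hence this definition. *)
Definition l1norm (R : realType) (n : nat) (v : 'cV[R]_n) : R :=
  \sum_i `|v i 0|.

Definition signv (R : realType) (n : nat) (v : 'cV[R]_n) : 'cV[R]_n :=
  map_mx Num.sg v.

Definition gibbs_weight (R : realType) (m n : nat) (beta : R)
    (c : 'M[R]_(m, n)) (lam : 'cV[R]_m * 'cV[R]_n) (i : 'I_m) (j : 'I_n) : R :=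
  expR (- beta * (c i j - lam.1 i 0 - lam.2 j 0)).

Definition partition_fun (R : realType) (m n : nat) (beta : R)
    (c : 'M[R]_(m, n)) (lam : 'cV[R]_m * 'cV[R]_n) : R :=
  \sum_i \sum_j gibbs_weight beta c lam i j.

Definition dual_obj (R : realType) (m n : nat) (beta : R)
    (mu : 'cV[R]_m) (nu : 'cV[R]_n) (c : 'M[R]_(m, n))
    (lam : 'cV[R]_m * 'cV[R]_n) : R :=
  - dotv mu lam.1 - dotv nu lam.2 + beta^-1 * ln (partition_fun beta c lam).

Definition gibbs (R : realType) (m n : nat) (beta : R)
    (c : 'M[R]_(m, n)) (lam : 'cV[R]_m * 'cV[R]_n) : 'M[R]_(m, n) :=
  \matrix_(i, j) (gibbs_weight beta c lam i j / partition_fun beta c lam).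

Definition center (R : realType) (n : nat) (v : 'cV[R]_n) : 'cV[R]_n :=
  v - const_mx (n%:R^-1 * dotv (const_mx 1) v).

Definition sign_step (R : realType) (n : nat) (eta : R)
    (marg target v : 'cV[R]_n) : 'cV[R]_n :=
  v - (eta / 2 * l1norm (marg - target)) *: signv (marg - target).

Definition ascent_step (R : realType) (m n : nat) (beta eta : R)
    (mu : 'cV[R]_m) (nu : 'cV[R]_n) (c : 'M[R]_(m, n))
    (lam : 'cV[R]_m * 'cV[R]_n) : 'cV[R]_m * 'cV[R]_n :=
  let pi := gibbs beta c lam in
  let mu_t := pi *m const_mx 1 in
  let nu_t := pi^T *m const_mx 1 in
  (center (sign_step eta mu_t mu lam.1), center (sign_step eta nu_t nu lam.2)).

Definition dual_ascent (R : realType) (m n : nat) (beta eta : R)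
    (mu : 'cV[R]_m) (nu : 'cV[R]_n) (c : 'M[R]_(m, n)) (t : nat) :
    'cV[R]_m * 'cV[R]_n :=
  iter t (ascent_step beta eta mu nu c) (0, 0).

(* Main.v *)
(* The objective is convex, unchanged by adding constants to either block, and
   smooth for the sup norms of the blocks, because the log-partition function
   obeys a Hoeffding-type bound.  The signed step is steepest descent for these
   norms, so it decreases the objective by at least [eta / 8] times the sum of
   the squared l1 norms of the two blocks of the gradient.

   If [phi_k] lags behind some [phi_i] by more than
   [r = 2 M + ln (1 / s) / beta], then the k-th Gibbs marginal is below [s],
   hence below [mu_k], and the step raises [phi_k] at full speed.  The spread of
   the iterates thus never exceeds [r + 2 / beta], while that of a minimizer,
   where the gradient vanishes, is at most [r].  These two add up to [2 K], with
   [K = 2 M + (ln (1 / s) + 1) / beta]; by convexity the gap is at most [K] times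
   the l1 norm of the gradient, so it decreases at each step by at least a
   multiple of its square, which gives the rate [1 / t]. *)

Require Import Defs.
From HB Require Import structures.
From mathcomp Require Import all_boot all_order all_algebra.
From mathcomp Require Import ring lra.
From mathcomp Require Import normedtype.
From mathcomp Require Import reals sequences exp.

Set Implicit Arguments.
Unset Strict Implicit.
Unset Printing Implicit Defensive.

Import Order.TTheory GRing.Theory Num.Theory.
Import numFieldNormedType.Exports.
Local Open Scope ring_scope.

(** * Quadratic bounds on the exponential and on exponential moments *)

Lemma fact_ge_exp3 n : (2 * 3 ^ n <= n.+2`!)%N.
Proof.
elim: n => [//|n IHn]; rewrite expnS factS mulnCA.
by apply: leq_mul.
Qed.

(** The term of degree [n.+2] is at most [x ^+ 2 / (2 * 3 ^ n)]; the factor [3 / 4] comes from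
    summing this geometric series. *)
Lemma series_exp_coeff_le (R : realType) (x : R) n : `|x| <= 1 ->
  series (exp_coeff x) n.+2 <= 1 + x + 3 / 4 * x ^+ 2 * (1 - 3^-1 ^+ n).
Proof.
move=> x1; elim: n => [|n IHn].
  rewrite /series /= !big_nat_recr //= big_nil /exp_coeff /=.
  by rewrite !factS fact0 /= !expr0 expr1 subrr !divr1; lra.
rewrite seriesS.
have -> : 1 + x + 3 / 4 * x ^+ 2 * (1 - 3^-1 ^+ n.+1) =
  x ^+ 2 * (2^-1 * 3^-1 ^+ n) + (1 + x + 3 / 4 * x ^+ 2 * (1 - 3^-1 ^+ n)).
  by rewrite [3^-1 ^+ n.+1]exprS; move: (_ ^+ n) => y; field.
apply: lerD => //; rewrite /exp_coeff /=.
apply: le_trans (ler_norm _) _; rewrite normrM normrX normfV normr_nat.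
rewrite -addn2 exprD -mulrA [leLHS]mulrCA -(real_normK (num_real x)).
apply: ler_wpM2l; first exact: exprn_ge0.
apply: le_trans (_ : (n + 2)`!%:R^-1 <= _).
  by apply: ler_piMl; rewrite ?invr_ge0 ?ler0n // exprn_ile1.
rewrite exprVn -invfM lef_pV2 ?posrE ?mulr_gt0 ?exprn_gt0 ?ltr0n ?fact_gt0 //.
by rewrite -natrX -natrM ler_nat addn2 fact_ge_exp3.
Qed.

Lemma expR_le1DxD2 (R : realType) (x : R) : `|x| <= 1 ->
  expR x <= 1 + x + 3 / 4 * x ^+ 2.
Proof.
move=> x1; apply: limr_le; first exact: is_cvg_series_exp_coeff.
exists 2%N => // -[//|[//|n]] _ /=.
apply: le_trans (series_exp_coeff_le n x1) _.
rewrite lerD2l; apply: ler_piMr; first by rewrite mulr_ge0 ?sqr_ge0 //; lra.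
by rewrite lerBlDr lerDl exprn_ge0 // invr_ge0.
Qed.

Lemma mgf_le_small (R : realType) (I : finType) (p X : I -> R) (B : R) :
  (forall i, 0 <= p i) -> \sum_i p i = 1 -> (forall i, `|X i| <= B) -> B <= 1 ->
  \sum_i p i * expR (X i) <= expR (\sum_i p i * X i + 3 / 4 * B ^+ 2).
Proof.
move=> p0 p1 XB B1.
apply: le_trans (expR_ge1Dx _).
have -> : 1 + (\sum_i p i * X i + 3 / 4 * B ^+ 2) =
  \sum_i p i * (1 + X i + 3 / 4 * B ^+ 2).
  under [RHS]eq_bigr do rewrite mulrDr mulrDr mulr1.
  by rewrite !big_split /= -mulr_suml p1 mul1r addrA.
apply: ler_sum => i _.
apply: le_trans (ler_wpM2l (p0 i) (expR_le1DxD2 (le_trans (XB i) B1))) _.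
apply: ler_wpM2l => //; rewrite lerD2l; apply: ler_wpM2l; first by lra.
rewrite -(real_normK (num_real (X i))) ler_sqr ?nnegrE //.
exact: le_trans (XB i).
Qed.

(* A weak form of Hoeffding's lemma (whose sharp constant is 1/2).  With
   [W := expR (X / 2)] and [r := expR (B / 2)], [W] lies between [1 / r] and
   [r], so that [W ^ 2 + 1 <= (r + 1 / r) W]; taking means, AM-GM compares the
   mean of [W ^ 2] with the square of the mean of [W], and [X / 2] is small
   enough for the quadratic bound on the exponential. *)
Lemma mgf_le (R : realType) (I : finType) (p X : I -> R) (B : R) :
  (forall i, 0 <= p i) -> \sum_i p i = 1 -> (forall i, `|X i| <= B) -> B <= 2 ->
  \sum_i p i * expR (X i) <= expR (\sum_i p i * X i + 3 / 4 * B ^+ 2).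
Proof.
move=> p0 p1 XB B2.
have [i0 B0] : exists i : I, 0 <= B.
  case: (pickP I) => [i _|I0]; first by exists i; exact: le_trans (XB i).
  by move: p1; rewrite big_pred0 // => /esym/eqP; rewrite oner_eq0.
set W := fun i => expR (X i / 2); set k := expR (3 / 16 * B ^+ 2).
set r := expR (B / 2).
have EW : \sum_i p i * W i <= expR ((\sum_i p i * X i) / 2 + 3 / 16 * B ^+ 2).
  have := @mgf_le_small R I p (fun i => X i / 2) (B / 2) p0 p1.
  move=> /(_ _ _)/le_trans; apply.
  - by move=> i; rewrite normrM (ger0_norm (x := 2^-1)) ?invr_ge0 //
      ler_wpM2r ?invr_ge0.
  - lra.
  rewrite ler_expR lerD ?mulr_suml //; last by rewrite expr_div_n; lra.
  by apply: ler_sum => i _; rewrite mulrA.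
have rk : r + r^-1 <= 2 * k.
  have n1 : `|B / 2| <= 1 by rewrite ger0_norm; lra.
  have n2 : `|- (B / 2)| <= 1 by rewrite normrN.
  have := expR_ge1Dx (3 / 16 * B ^+ 2); rewrite -/k.
  have := expR_le1DxD2 n1; have := expR_le1DxD2 n2.
  by rewrite expRN -/r sqrrN expr_div_n; lra.
have W1 i : expR (X i) + 1 <= (2 * k) * W i.
  have r0 : 0 < r := expR_gt0 _; have W0 : 0 < W i := expR_gt0 _.
  have -> : expR (X i) = W i ^+ 2 by rewrite -expRM_natr; congr expR; field.
  have /andP[Wl Wr] : r^-1 <= W i <= r.
    by move: (XB i); rewrite -expRN !ler_expR ler_norml; lra.
  apply: le_trans (ler_wpM2r (ltW W0) rk).
  have rV : r * r^-1 = 1 by rewrite divff ?gt_eqF.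
  have : 0 <= (r - W i) * (W i - r^-1) by rewrite mulr_ge0 // subr_ge0.
  by rewrite mulrBl !mulrBr rV; nra.
have E1 : (\sum_i p i * expR (X i)) + 1 <= 2 * k * (\sum_i p i * W i).
  rewrite -[X in _ + X]p1 -big_split mulr_sumr; apply: ler_sum => i _ /=.
  by rewrite -[X in _ + X]mulr1 -mulrDr mulrCA ler_wpM2l.
have k0 : 0 < k := expR_gt0 _.
have EW0 : 0 <= \sum_i p i * W i.
  by apply: sumr_ge0 => i _; rewrite mulr_ge0 ?expR_ge0.
apply: le_trans (_ : (k * (\sum_i p i * W i)) ^+ 2 <= _).
  by have := sqr_ge0 (k * (\sum_i p i * W i) - 1); nra.
apply: le_trans (_ : (k * expR ((\sum_i p i * X i) / 2 + 3 / 16 * B ^+ 2)) ^+ 2 <= _).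
  by rewrite ler_sqr ?nnegrE ?mulr_ge0 ?expR_ge0 ?(ltW k0) // ler_wpM2l // ltW.
by rewrite -expRD -expRM_natr ler_expR; lra.
Qed.

(** Jensen's inequality, from the tangent line of the exponential at the mean [m]. *)
Lemma mgf_ge (R : realType) (I : finType) (p X : I -> R) :
  (forall i, 0 <= p i) -> \sum_i p i = 1 ->
  expR (\sum_i p i * X i) <= \sum_i p i * expR (X i).
Proof.
move=> p0 p1; set m := \sum_i p i * X i.
apply: le_trans (_ : \sum_i p i * (expR m * (1 + (X i - m))) <= _).
  under eq_bigr do rewrite mulrCA.
  rewrite -mulr_sumr; apply: ler_peMr; first exact: expR_ge0.
  under eq_bigr do rewrite mulrDr mulr1 mulrBr.
  by rewrite big_split sumrB -mulr_suml p1 /= -/m mul1r subrr addr0.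
apply: ler_sum => i _; apply: ler_wpM2l => //.
rewrite -[X in _ <= expR X](subrK m) [_ - m + m]addrC expRD.
by rewrite ler_wpM2l ?expR_ge0 ?expR_ge1Dx.
Qed.

(** The two marginals convert to [mu_t] and [nu_t] in [ascent_step]; minus [mu] and [nu], they are
    the blocks of the gradient of [dual_obj]. *)
Definition row_marg (R : realType) (m n : nat) (beta : R) (c : 'M[R]_(m, n))
    (lam : 'cV[R]_m * 'cV[R]_n) : 'cV[R]_m :=
  gibbs beta c lam *m const_mx 1.

Definition col_marg (R : realType) (m n : nat) (beta : R) (c : 'M[R]_(m, n))
    (lam : 'cV[R]_m * 'cV[R]_n) : 'cV[R]_n :=
  (gibbs beta c lam)^T *m const_mx 1.

(** * Pairings with differences of probability vectors *)

Section Vectors.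
Variables (R : realType) (n : nat).
Implicit Types u v p q d : 'cV[R]_n.

Lemma dotvE u v : dotv u v = \sum_i u i 0 * v i 0.
Proof. by rewrite /dotv mxE; apply: eq_bigr => i _; rewrite mxE. Qed.

Lemma l1norm_ge0 v : 0 <= l1norm v.
Proof. by apply: sumr_ge0. Qed.

Lemma l1norm_eq0 v : l1norm v = 0 -> v = 0.
Proof.
move=> v0; apply/colP => i; rewrite mxE; apply/eqP.
by rewrite -normr_le0 -v0 /l1norm (bigD1 i) //= lerDl sumr_ge0.
Qed.

Lemma dotv_signv v : dotv v (signv v) = l1norm v.
Proof.
by rewrite dotvE; apply: eq_bigr => i _; rewrite mxE mulrC -normrEsg.
Qed.

Lemma dotvZr a u v : dotv u (a *: v) = a * dotv u v.
Proof. by rewrite /dotv -scalemxAr mxE. Qed.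

Lemma dotvBl p q v : dotv (p - q) v = dotv p v - dotv q v.
Proof. by rewrite /dotv linearB mulmxBl mxE [in X in _ + X]mxE. Qed.

Lemma dotvDr u p q : dotv u (p + q) = dotv u p + dotv u q.
Proof. by rewrite /dotv mulmxDr mxE. Qed.

Lemma dotvBr u p q : dotv u (p - q) = dotv u p - dotv u q.
Proof. by rewrite /dotv mulmxBr mxE [in X in _ + X]mxE. Qed.

Lemma dotv_const_prob p q a : prob_vec p -> prob_vec q ->
  dotv (p - q) (const_mx a) = 0.
Proof.
move=> [_ p1] [_ q1]; rewrite dotvBl !dotvE.
by under eq_bigr do rewrite mxE; under [in X in _ - X]eq_bigr do rewrite mxE;
  rewrite -!mulr_suml p1 q1 subrr.
Qed.

Lemma l1norm_probB p q : prob_vec p -> prob_vec q -> l1norm (p - q) <= 2.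
Proof.
move=> [p0 p1] [q0 q1]; rewrite [2](_ : _ = \sum_i (p i 0 + q i 0)).
  apply: ler_sum => i _; rewrite !mxE.
  by apply: le_trans (ler_normB _ _) _; rewrite !ger0_norm.
by rewrite big_split /= p1 q1.
Qed.

Lemma prob_vec_ord p : prob_vec p -> 'I_n.
Proof.
move=> [_ p1]; case: (posnP n) => [n0|n0]; last exact: (Ordinal n0).
exfalso; move: p1; rewrite big1 => [/esym/eqP|[i lti]]; first by rewrite oner_eq0.
by exfalso; rewrite n0 in lti.
Qed.

(** Hölder's inequality after recentring: [p - q] annihilates constants, and subtracting the maximum
    of [d] minus [K] puts its entries in [[- K, K]]. *)
Lemma dotv_probB_le p q d K : prob_vec p -> prob_vec q ->
  (forall i k, d i 0 - d k 0 <= 2 * K) ->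
  dotv (p - q) d <= K * l1norm (p - q).
Proof.
move=> hp hq hd; have i0 := prob_vec_ord hp.
have [j _ dj] := arg_maxP (fun i => d i 0) (erefl true : predT i0).
rewrite -[d](subrK (const_mx (d j 0 - K))) dotvDr dotv_const_prob // addr0.
rewrite dotvE /l1norm mulr_sumr; apply: ler_sum => i _.
apply: le_trans (ler_norm _) _; rewrite normrM mulrC ler_wpM2r //.
by rewrite !mxE ler_norml; have := hd j i; have /= := dj i isT; lra.
Qed.

(* Entries that lag by more than [r] move up by [h], whereas all the others
   move by at most [h]. *)
Lemma sign_step_spread (eta r h : R) p q v :
  0 <= eta -> eta / 2 * l1norm (p - q) <= h ->
  (forall i k, r < v i 0 - v k 0 -> p k 0 < q k 0) ->
  (forall i k, v i 0 - v k 0 <= r + 2 * h) ->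
  let w := Defs.center (sign_step eta p q v) in
  forall i k, w i 0 - w k 0 <= r + 2 * h.
Proof.
move=> eta0 lh lag hv w i k; rewrite /w !mxE.
set a := eta / 2 * _ in lh *; set b := _ * dotv _ _.
have a0 : 0 <= a by rewrite mulr_ge0 ?l1norm_ge0 // divr_ge0.
have sg_bound x : - a <= a * Num.sg x <= a.
  by case: sgrP => _; lra.
have /andP[i1 i2] := sg_bound (p i 0 - q i 0).
have [lt_r|le_r] := ltP r (v i 0 - v k 0).
  have := hv i k; rewrite [Num.sg (p k 0 - _)]ltr0_sg ?subr_lt0 ?(lag i k) //.
  by lra.
by have /andP[k1 k2] := sg_bound (p k 0 - q k 0); lra.
Qed.

End Vectors.

(** * The Gibbs matrix and its marginals *)

Section Gibbs.
Variables (R : realType) (m n : nat) (beta : R) (c : 'M[R]_(m, n)).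
Implicit Types lam d : 'cV[R]_m * 'cV[R]_n.

Lemma row_margE lam i : row_marg beta c lam i 0 = \sum_j gibbs beta c lam i j.
Proof. by rewrite mxE; apply: eq_bigr => j _; rewrite [const_mx _ _ _]mxE mulr1. Qed.

Lemma col_margE lam j : col_marg beta c lam j 0 = \sum_i gibbs beta c lam i j.
Proof.
by rewrite mxE; apply: eq_bigr => i _; rewrite [const_mx _ _ _]mxE mulr1 mxE.
Qed.

Lemma partition_fun_tr lam :
  partition_fun beta c^T (lam.2, lam.1) = partition_fun beta c lam.
Proof.
rewrite /partition_fun exchange_big /=; apply: eq_bigr => i _; apply: eq_bigr => j _.
by rewrite /gibbs_weight mxE /= addrAC.
Qed.

Lemma gibbs_sum1 lam : 0 < partition_fun beta c lam ->
  \sum_i \sum_j gibbs beta c lam i j = 1.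
Proof.
move=> Z0; under eq_bigr do under eq_bigr do rewrite mxE.
by under eq_bigr do rewrite -mulr_suml; rewrite -mulr_suml divff // gt_eqF.
Qed.

Hypotheses (i0 : 'I_m) (j0 : 'I_n).

Lemma partition_fun_gt0 lam : 0 < partition_fun beta c lam.
Proof.
rewrite /partition_fun (bigD1 i0) //= (bigD1 j0) //=.
apply: ltr_wpDr; first by do 2!apply: sumr_ge0 => ? _; exact: expR_ge0.
by apply: ltr_wpDr; [apply: sumr_ge0 => ? _; exact: expR_ge0|exact: expR_gt0].
Qed.
Let Z_gt0 := partition_fun_gt0.

Lemma gibbs_ge0 lam i j : 0 <= gibbs beta c lam i j.
Proof. by rewrite mxE divr_ge0 ?expR_ge0 ?ltW ?Z_gt0. Qed.

Lemma row_marg_prob lam : prob_vec (row_marg beta c lam).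
Proof.
split=> [i|]; first by rewrite row_margE; apply: sumr_ge0 => j _; apply: gibbs_ge0.
by under eq_bigr do rewrite row_margE; exact: gibbs_sum1.
Qed.

Lemma col_marg_prob lam : prob_vec (col_marg beta c lam).
Proof.
split=> [i|]; first by rewrite col_margE; apply: sumr_ge0 => j _; apply: gibbs_ge0.
by under eq_bigr do rewrite col_margE; rewrite exchange_big; exact: gibbs_sum1.
Qed.

(** Costs differ by at most [2 * M], so row [k] of the Gibbs matrix times [expR x] is entrywise at
    most row [i], whose mass is at most 1; the lag makes [expR x] exceed [s^-1]. *)
Lemma row_marg_lt (M s : R) lam i k :
  0 < beta -> 0 < s -> (forall i' j, `|c i' j| <= M) ->
  2 * M + ln (1 / s) / beta < lam.1 i 0 - lam.1 k 0 ->
  row_marg beta c lam k 0 < s.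
Proof.
move=> beta0 s0 cM lag; set x := beta * (lam.1 i 0 - lam.1 k 0 - 2 * M).
have sx : s^-1 < expR x.
  rewrite -[s^-1]lnK ?posrE ?invr_gt0 // ltr_expR.
  by move: lag; rewrite div1r addrC -ltrBrDr ltr_pdivrMr // mulrC.
have [p0 p1] := row_marg_prob lam.
suff : row_marg beta c lam k 0 * expR x <= 1.
  move=> h; rewrite -[s]invrK -div1r ltr_pdivlMr ?invr_gt0 //.
  have [->|pk] := eqVneq (row_marg beta c lam k 0) 0; first by rewrite mul0r.
  by apply: lt_le_trans h; rewrite ltr_pM2l // lt_def pk p0.
apply: le_trans (_ : row_marg beta c lam i 0 <= _); last first.
  by rewrite -p1 (bigD1 i) //= lerDl sumr_ge0.
rewrite !row_margE mulr_suml; apply: ler_sum => j _; rewrite !mxE.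
rewrite mulrAC ler_pM2r ?invr_gt0 ?Z_gt0 // -expRD ler_expR.
have := cM i j; have := cM k j; rewrite !ler_norml => /andP[k1 _] /andP[_ i1].
rewrite -subr_ge0 (_ : _ - _ = beta * (2 * M + c k j - c i j)).
  by rewrite mulr_ge0 ?(ltW beta0) //; lra.
by rewrite /x; ring.
Qed.

End Gibbs.

(** Swapping the blocks and transposing the cost reduces column bounds to row bounds. *)
Lemma col_marg_tr (R : realType) (m n : nat) (beta : R) (c : 'M[R]_(m, n))
    (lam : 'cV[R]_m * 'cV[R]_n) :
  col_marg beta c lam = row_marg beta c^T (lam.2, lam.1).
Proof.
apply/colP => j; rewrite row_margE col_margE; apply: eq_bigr => i _.
by rewrite !mxE partition_fun_tr /gibbs_weight mxE /= addrAC.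
Qed.

(** * First- and second-order bounds on the dual objective *)

Section DualObjective.
Variables (R : realType) (m n : nat) (mu : 'cV[R]_m) (nu : 'cV[R]_n).
Variables (c : 'M[R]_(m, n)) (beta : R).
Hypotheses (hmu : prob_vec mu) (hnu : prob_vec nu) (beta_gt0 : 0 < beta).
Implicit Types lam d : 'cV[R]_m * 'cV[R]_n.

Let f := dual_obj beta mu nu c.
Let g1 lam := row_marg beta c lam - mu.
Let g2 lam := col_marg beta c lam - nu.
Let i0 := prob_vec_ord hmu.
Let j0 := prob_vec_ord hnu.
(** The Gibbs matrix as one probability on pairs, and the variable by which a move [d] tilts it. *)
Let p lam (ij : 'I_m * 'I_n) := gibbs beta c lam ij.1 ij.2.
Let X d (ij : 'I_m * 'I_n) := beta * (d.1 ij.1 0 + d.2 ij.2 0).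

Let p_ge0 lam ij : 0 <= p lam ij.
Proof. exact: gibbs_ge0. Qed.

Let p_sum1 lam : \sum_ij p lam ij = 1.
Proof.
rewrite -(pair_bigA _ (gibbs beta c lam)) /=; apply: gibbs_sum1.
exact: partition_fun_gt0.
Qed.

(** The ratio of the two partition functions is the Gibbs mean of [expR (X d)], so moment bounds
    control the increments of [f]. *)
Lemma dual_obj_diff lam d : f (lam + d) - f lam =
  - dotv mu d.1 - dotv nu d.2 + beta^-1 * ln (\sum_ij p lam ij * expR (X d ij)).
Proof.
have Z0 := partition_fun_gt0 beta c i0 j0.
have -> : \sum_ij p lam ij * expR (X d ij) =
    partition_fun beta c (lam + d) / partition_fun beta c lam.
  rewrite -(pair_bigA _ (fun i j => gibbs beta c lam i j * expR (X d (i, j)))) /=.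
  rewrite /partition_fun mulr_suml; apply: eq_bigr => i _.
  rewrite mulr_suml; apply: eq_bigr => j _.
  rewrite mxE mulrAC -expRD /gibbs_weight /X !mxE /=; congr (expR _ / _); ring.
rewrite ln_div ?posrE ?Z0 // /f /dual_obj /= !dotvDr; ring.
Qed.

Let sum_pX lam d :
  \sum_ij p lam ij * X d ij =
  beta * (dotv (row_marg beta c lam) d.1 + dotv (col_marg beta c lam) d.2).
Proof.
rewrite -(pair_bigA _ (fun i j => gibbs beta c lam i j * X d (i, j))) /=.
rewrite !dotvE mulrDr !mulr_sumr.
under [in X in _ = X + _]eq_bigr do rewrite row_margE mulr_suml mulr_sumr.
under [in X in _ = _ + X]eq_bigr do rewrite col_margE mulr_suml mulr_sumr.
rewrite [in X in _ = _ + X]exchange_big -big_split; apply: eq_bigr => i _ /=.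
by rewrite -big_split; apply: eq_bigr => j _ /=; rewrite /X /=; ring.
Qed.

Let sum_exp_gt0 lam d : 0 < \sum_ij p lam ij * expR (X d ij).
Proof. exact: lt_le_trans (expR_gt0 _) (mgf_ge _ _ _). Qed.

Lemma dual_obj_convex lam d :
  dotv (g1 lam) d.1 + dotv (g2 lam) d.2 <= f (lam + d) - f lam.
Proof.
rewrite dual_obj_diff !dotvBl.
have := mgf_ge (X d) (p_ge0 lam) (p_sum1 lam).
rewrite -{1}[\sum_ij _ * expR _]lnK ?posrE ?sum_exp_gt0 // ler_expR sum_pX.
by rewrite -ler_pdivlMl //; lra.
Qed.

(** This is [mgf_le] with [B = beta * (a + b)]; the prefactor [beta^-1] leaves a single [beta] in
    the quadratic term. *)
Lemma dual_obj_smooth lam d a b :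
  (forall i, `|d.1 i 0| <= a) -> (forall j, `|d.2 j 0| <= b) ->
  beta * (a + b) <= 2 ->
  f (lam + d) - f lam <=
  dotv (g1 lam) d.1 + dotv (g2 lam) d.2 + 3 / 4 * beta * (a + b) ^+ 2.
Proof.
move=> da db hab; rewrite dual_obj_diff !dotvBl.
have Xab ij : `|X d ij| <= beta * (a + b).
  rewrite normrM gtr0_norm // ler_pM2l //.
  by apply: le_trans (ler_normD _ _) _; apply: lerD.
have := mgf_le (p_ge0 lam) (p_sum1 lam) Xab hab.
rewrite -{1}[\sum_ij _ * expR _]lnK ?posrE ?sum_exp_gt0 // ler_expR sum_pX.
set S := dotv _ d.1 + _; have -> : beta * S + 3 / 4 * (beta * (a + b)) ^+ 2 =
  beta * (S + 3 / 4 * beta * (a + b) ^+ 2) by ring.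
by rewrite -ler_pdivrMl // /S; lra.
Qed.

(** The gradient annihilates constants, so by convexity no shift decreases [f]; the opposite shift
    gives equality. *)
Lemma dual_obj_shift (u : 'cV[R]_m) (v : 'cV[R]_n) a b :
  f (u + const_mx a, v + const_mx b) = f (u, v).
Proof.
have le lam a1 b1 : f lam <= f (lam + (const_mx a1, const_mx b1)).
  rewrite -subr_ge0; apply: le_trans (dual_obj_convex _ _).
  rewrite /= !dotv_const_prob ?addr0 //; first exact: col_marg_prob.
  exact: row_marg_prob.
apply/le_anti/andP; split; last by have := le (u, v) a b.
have := le (u + const_mx a, v + const_mx b) (- a) (- b); congr (_ <= f _).
by congr (_, _); apply/colP => i; rewrite !mxE addrK.
Qed.

(** The linear gain is [eta / 2] times the sum of squares. Since [eta * beta <= 1] and [(G1 + G2) ^+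
    2 <= 2 * (G1 ^+ 2 + G2 ^+ 2)], the quadratic loss is at most [3 / 8 * eta] times it, leaving
    [eta / 8]. *)
Lemma ascent_step_descent eta lam : 0 < eta -> eta * beta <= 1 ->
  f (ascent_step beta eta mu nu c lam) <=
  f lam - eta / 8 * (l1norm (g1 lam) ^+ 2 + l1norm (g2 lam) ^+ 2).
Proof.
move=> eta0 etab; set G1 := l1norm (g1 lam); set G2 := l1norm (g2 lam).
have G10 : 0 <= G1 := l1norm_ge0 _; have G20 : 0 <= G2 := l1norm_ge0 _.
have G12 : G1 <= 2 := l1norm_probB (row_marg_prob beta c i0 j0 lam) hmu.
have G22 : G2 <= 2 := l1norm_probB (col_marg_prob beta c i0 j0 lam) hnu.
set d : 'cV[R]_m * 'cV[R]_n :=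
  (- (eta / 2 * G1) *: signv (g1 lam), - (eta / 2 * G2) *: signv (g2 lam)).
have -> : f (ascent_step beta eta mu nu c lam) = f (lam + d).
  have centerE k (v : 'cV[R]_k) : exists a, Defs.center v = v + const_mx a.
    by exists (- (k%:R^-1 * dotv (const_mx 1) v)); apply/colP => i; rewrite !mxE.
  have [a Ea] := centerE _ (sign_step eta (row_marg beta c lam) mu lam.1).
  have [b Eb] := centerE _ (sign_step eta (col_marg beta c lam) nu lam.2).
  by rewrite /ascent_step Ea Eb dual_obj_shift /d !scaleNr.
have sgn k (v : 'cV[R]_k) a i : 0 <= a -> `|(- a *: signv v) i 0| <= a.
  move=> a0; rewrite !mxE normrM normrN (ger0_norm a0).
  by rewrite ler_piMr // normr_sg lern1 leq_b1.
have a0 : 0 <= eta / 2 * G1 by rewrite !mulr_ge0 ?invr_ge0 // ltW.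
have b0 : 0 <= eta / 2 * G2 by rewrite !mulr_ge0 ?invr_ge0 // ltW.
(* As [G1] and [G2] are at most 2, the move just meets the range allowed by [dual_obj_smooth]. *)
have hab : beta * (eta / 2 * G1 + eta / 2 * G2) <= 2.
  have : eta * beta * (G1 + G2) <= 1 * (2 + 2).
    by apply: ler_pM => //; rewrite ?mulr_ge0 ?addr_ge0 ?lerD // ltW.
  by lra.
have := dual_obj_smooth lam (d := d) (fun i => sgn _ (g1 lam) _ i a0)
  (fun j => sgn _ (g2 lam) _ j b0) hab.
rewrite /= !dotvZr !dotv_signv -/G1 -/G2 => h.
rewrite -lerBlDl; apply: le_trans h _.
have : eta * beta * (eta * (G1 + G2) ^+ 2) <= 1 * (eta * (2 * (G1 ^+ 2 + G2 ^+ 2))).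
  apply: ler_pM => //; last by rewrite ler_pM2l //; have := sqr_ge0 (G1 - G2); nra.
    by rewrite mulr_ge0 // ltW.
  by rewrite mulr_ge0 ?sqr_ge0 // ltW.
by nra.
Qed.

End DualObjective.

(** * The rate of convergence *)

(** A discrete form of [x' = - x ^ 2 / C]. The induction avoids reciprocals, so [x t] may vanish. *)
Lemma quadratic_decrease_rate (R : realFieldType) (C : R) (x : nat -> R) :
  0 < C -> (forall t, 0 <= x t) -> (forall t, x t ^+ 2 <= C * (x t - x t.+1)) ->
  forall t, t%:R * x t <= C.
Proof.
move=> C0 x0 hx; elim=> [|t IHt]; first by rewrite mul0r ltW.
(* Since [x t.+1] is nonnegative, the square of [x t] is at most [C * x t]. *)
have xC : x t <= C.
  have [->|xt] := eqVneq (x t) 0; first exact: ltW.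
  have : x t * x t <= C * x t.
    by rewrite -expr2; apply: le_trans (hx t) _; rewrite ler_pM2l // lerBlDr lerDl.
  by rewrite ler_pM2r // lt_def xt x0.
have t0 : 0 <= t%:R :> R by [].
rewrite -(ler_pM2l C0) mulrCA.
apply: le_trans (_ : t.+1%:R * (C * x t - x t ^+ 2) <= _).
  by rewrite ler_wpM2l //; have := hx t; lra.
have : t%:R * x t * (C - x t) <= C * (C - x t) by rewrite ler_wpM2r // subr_ge0.
by rewrite -natr1; have := sqr_ge0 (x t); nra.
Qed.

Theorem theorem21 (R : realType) (m n : nat)
    (mu : 'cV[R]_m) (nu : 'cV[R]_n) (c : 'M[R]_(m, n))
    (hmu : prob_vec mu) (hnu : prob_vec nu)
    (beta eta : R) (hbeta : 0 < beta) (heta0 : 0 < eta) (heta : eta <= 1 / beta)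
    (M s : R) (hM : 0 < M) (hs : 0 < s)
    (hmu_s : forall i : 'I_m, s <= mu i 0)
    (hnu_s : forall j : 'I_n, s <= nu j 0)
    (hc : forall (i : 'I_m) (j : 'I_n), `|c i j| <= M)
    (lam_star : 'cV[R]_m * 'cV[R]_n)
    (hstar : forall lam : 'cV[R]_m * 'cV[R]_n,
        dual_obj beta mu nu c lam_star <= dual_obj beta mu nu c lam)
    (T t : nat) (ht : (1 <= t <= T)%N) :
  dual_obj beta mu nu c (dual_ascent beta eta mu nu c t)
    - dual_obj beta mu nu c lam_star
  <= 32 * (2 * M + (ln (1 / s) + 1) / beta) ^+ 2 / (t%:R * eta).
Proof.
have i0 := prob_vec_ord hmu; have j0 := prob_vec_ord hnu.
set r := 2 * M + ln (1 / s) / beta; set K := 2 * M + _ / beta.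
have s1 : s <= 1.
  apply: le_trans (hmu_s i0) _; have [mu0 <-] := hmu.
  by rewrite (bigD1 i0) //= lerDl sumr_ge0.
have r0 : 0 < r.
  by rewrite ltr_wpDr ?mulr_gt0 // divr_ge0 ?(ltW hbeta) // ln_ge0 // div1r invf_ge1.
(* The spread of a minimizer plus that of an iterate. *)
have rK : 2 * K = r + (r + 2 * beta^-1) by rewrite /K /r mulrDl; lra.
have bV0 : 0 < beta^-1 by rewrite invr_gt0.
have K0 : 0 < K by lra.
have etab : eta * beta <= 1 by rewrite -ler_pdivlMr.
have lag1 (lam : 'cV[R]_m * 'cV[R]_n) i k :
    r < lam.1 i 0 - lam.1 k 0 -> row_marg beta c lam k 0 < mu k 0.
  by move=> h; apply: lt_le_trans (hmu_s k); exact: (row_marg_lt i0 j0 hbeta hs hc h).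
have lag2 (lam : 'cV[R]_m * 'cV[R]_n) i k :
    r < lam.2 i 0 - lam.2 k 0 -> col_marg beta c lam k 0 < nu k 0.
  move=> h; apply: lt_le_trans (hnu_s k); rewrite col_marg_tr.
  have hcT j' i' : `|c^T j' i'| <= M by rewrite mxE.
  exact: (row_marg_lt j0 i0 (lam := (lam.2, lam.1)) hbeta hs hcT h).
set f := dual_obj beta mu nu c; set x := dual_ascent beta eta mu nu c.
set G := fun lam => l1norm (row_marg beta c lam - mu) ^+ 2
  + l1norm (col_marg beta c lam - nu) ^+ 2.
have descent lam : f (ascent_step beta eta mu nu c lam) <= f lam - eta / 8 * G lam.
  exact: ascent_step_descent.
have spread_star : (forall i k, lam_star.1 i 0 - lam_star.1 k 0 <= r) /\
    (forall i k, lam_star.2 i 0 - lam_star.2 k 0 <= r).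
  (* A step from a minimizer cannot decrease [f], so the descent estimate makes the gradient vanish,
     without any differentiation. *)
  have G0 : G lam_star <= 0.
    have := le_trans (hstar _) (descent lam_star).
    by rewrite lerBrDr gerDl pmulr_rle0 // divr_gt0.
  have e1 : row_marg beta c lam_star = mu.
    apply/subr0_eq/l1norm_eq0/eqP; rewrite -sqrf_eq0 eq_le sqr_ge0 andbT.
    by apply: le_trans G0; rewrite lerDl sqr_ge0.
  have e2 : col_marg beta c lam_star = nu.
    apply/subr0_eq/l1norm_eq0/eqP; rewrite -sqrf_eq0 eq_le sqr_ge0 andbT.
    by apply: le_trans G0; rewrite lerDr sqr_ge0.
  split=> i k; rewrite leNgt; apply/negP.
    by move=> /lag1; rewrite e1 ltxx.
  by move=> /lag2; rewrite e2 ltxx.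
(* With l1 norms at most 2, each coordinate moves by at most [beta^-1] before centring: this is [h]
   in [sign_step_spread]. *)
have half_eta a : a <= 2 -> eta / 2 * a <= beta^-1.
  move=> a2; apply: le_trans (_ : eta <= _); last by rewrite -div1r.
  by have := ler_wpM2l (ltW heta0) a2; lra.
have spread u : (forall i k, (x u).1 i 0 - (x u).1 k 0 <= r + 2 * beta^-1) /\
    (forall i k, (x u).2 i 0 - (x u).2 k 0 <= r + 2 * beta^-1).
  elim: u => [|u [IH1 IH2]]; first by split=> i k; rewrite !mxE subrr; lra.
  rewrite [x _]/= -/(x u); split; apply: sign_step_spread => //; try exact: ltW.
  - by apply: half_eta; apply: l1norm_probB => //; exact: row_marg_prob.
  - by move=> i k; apply: lag1.
  - by apply: half_eta; apply: l1norm_probB => //; exact: col_marg_prob.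
  - by move=> i k; apply: lag2.
have gap u : (f (x u) - f lam_star) ^+ 2 <= 2 * K ^+ 2 * G (x u).
  have [s1u s2u] := spread u; have [s1s s2s] := spread_star.
  have cvx := dual_obj_convex c hmu hnu hbeta (x u) (lam_star - x u).
  rewrite [_ + (_ - _)]addrC subrK -/f !dotvBr in cvx.
  have d1 i k : ((x u).1 - lam_star.1) i 0 - ((x u).1 - lam_star.1) k 0 <= 2 * K.
    by rewrite !mxE; have := s1u i k; have := s1s k i; lra.
  have d2 i k : ((x u).2 - lam_star.2) i 0 - ((x u).2 - lam_star.2) k 0 <= 2 * K.
    by rewrite !mxE; have := s2u i k; have := s2s k i; lra.
  have := dotv_probB_le (row_marg_prob beta c i0 j0 (x u)) hmu d1.
  have := dotv_probB_le (col_marg_prob beta c i0 j0 (x u)) hnu d2.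
  rewrite /G !dotvBr; set a := l1norm _; set b := l1norm _ => hb ha.
  have gap_le : f (x u) - f lam_star <= K * (a + b) by lra.
  apply: le_trans (_ : (K * (a + b)) ^+ 2 <= _).
    rewrite ler_sqr ?nnegrE ?subr_ge0 ?hstar // mulr_ge0 ?(ltW K0) //.
    by rewrite addr_ge0 ?l1norm_ge0.
  have ab : (a + b) ^+ 2 <= 2 * (a ^+ 2 + b ^+ 2).
    by have := sqr_ge0 (a - b); nra.
  by rewrite exprMn; have := ler_wpM2l (sqr_ge0 K) ab; lra.
(* The constant [C] solves [2 * K ^+ 2 = C * (eta / 8)], matching [gap] with [descent]. *)
have tK : t%:R * (f (x t) - f lam_star) <= 16 * K ^+ 2 / eta.
  apply: (@quadratic_decrease_rate _ _ (fun u => f (x u) - f lam_star)) => [|u|u].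
  - by rewrite !mulr_gt0 ?exprn_gt0 ?invr_gt0.
  - by rewrite subr_ge0.
  - apply: le_trans (gap u) _.
    have := descent (x u); rewrite -/(x u.+1) => h.
    rewrite (_ : _ * G _ = 16 * K ^+ 2 / eta * (eta / 8 * G (x u))); last first.
      by field; rewrite gt_eqF.
    rewrite ler_pM2l; last by rewrite !mulr_gt0 ?exprn_gt0 ?invr_gt0.
    rewrite /= -/(x u) -/(f _); lra.
have /andP[t1 _] := ht.
rewrite ler_pdivlMr ?mulr_gt0 ?ltr0n // mulrCA mulrA -ler_pdivlMr //.
apply: le_trans tK _.
(* The constant 16 obtained here is relaxed to 32. *)
rewrite ler_pM2r ?invr_gt0 // ler_wpM2r ?sqr_ge0 //; lra.
Qed.
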